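(* For each integer $n\ge1$ there exist constants $\varepsilon_{0}=\varepsilon_{0}(n)>0$ and $C_0=C_0(n)>1$ with the following property. If $1\leq n\leq N$, $E\subsetneq\mathbb{R}^{n}$ is closed, and $(f,E,\mathcal{A})$ is $\varepsilon$-almost affine for some $0<\varepsilon\leq \varepsilon_0$, where $f:E\to\mathbb{R}^N$, then the map $f:E\rightarrow\mathbb{R}^N$ can be extended to a $C_0\varepsilon$-almost affine map $F:\mathbb{R}^{n}\rightarrow \mathbb{R}^{N}$ such that $(F,\mathbb{R}^n,\mathcal{A}^+)$ is $C_0\varepsilon$-almost affine for some $C_0\varepsilon$-compatible family $\mathcal{A}^+=\{A^+_{x,r}:x\in\mathbb{R}^n,r>0\}$ of affine maps over $\mathbb{R}^n$ extending $\mathcal{A}$, i.e. $F|_E=f$ and $A^+_{x,r}=A_{x,r}$ for all $x\in E$ and $r>0$.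
   Context: $B^n(x,r)$ denotes the closed ball in $\mathbb{R}^n$. For an affine map $A:\mathbb{R}^n\to\mathbb{R}^N$, $A'$ denotes its linear part and $\|A'\|$ the operator norm. A family of affine maps over $E\subset\mathbb{R}^n$ is an indexed set $\mathcal{A}=\{A_{x,r}:x\in E,r>0\}$ of affine maps $A_{x,r}:\mathbb{R}^n\to\mathbb{R}^N$. For $\varepsilon>0$, $\mathcal{A}$ is $\varepsilon$-compatible if $\|A'_{x,r}-A'_{y,s}\|\leq\varepsilon\min\{\|A'_{x,r}\|,\|A'_{y,s}\|\}$ for all $x,y\in E$ and $r,s>0$ with $|x-y|\leq\max\{r,s\}$ and $1/2\leq r/s\leq2$. Let $E\subset X\subset\mathbb{R}^n$ and $\varepsilon>0$. A map $f:X\to\mathbb{R}^N$ is $\varepsilon$-almost affine over $E$ if there is an $\varepsilon$-compatible family $\mathcal{A}$ of affine maps over $E$ such that $\sup_{z\in E\cap B^n(x,r)}|f(z)-A_{x,r}(z)|\leq\varepsilon\|A'_{x,r}\|r$ for all $x\in E$, $r>0$; in this case we say $(f,E,\mathcal{A})$ is $\varepsilon$-almost affine. *)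

(* Defs.v *)
From HB Require Import structures.
From mathcomp Require Import all_boot all_order all_algebra.
From mathcomp Require Import all_classical all_reals all_analysis.

Set Implicit Arguments.
Unset Strict Implicit.
Unset Printing Implicit Defensive.

Import Order.TTheory GRing.Theory Num.Theory.
Import numFieldNormedType.Exports.

Local Open Scope classical_set_scope.
Local Open Scope ring_scope.

(* The library norm `|v| on 'rV[R]_n is the sup norm, hence this definition.
   Both norms induce the same topology, so the library's [closed] is the usual
   notion of closed set. *)
Definition enorm (R : realType) (n : nat) (v : 'rV[R]_n) : R :=
  Num.sqrt (\sum_(i < n) v ord0 i ^+ 2).

Definition cball (R : realType) (n : nat) (x : 'rV[R]_n) (r : R) :
    set 'rV[R]_n :=
  [set z | enorm (z - x) <= r].

(* Vectors are rows: the matrix L stands for the linear map v |-> v *m L. *)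
Definition opnorm (R : realType) (n N : nat) (L : 'M[R]_(n, N)) : R :=
  sup [set enorm (v *m L) | v in [set v : 'rV[R]_n | enorm v <= 1]].

(* An affine map R^n -> R^N determines its linear part and its value at 0, so
   equality in this type is equality of affine maps. *)
Record affine_map (R : realType) (n N : nat) := AffineMap {
  linear_part : 'M[R]_(n, N);
  affine_origin : 'rV[R]_N
}.

Definition affine_eval (R : realType) (n N : nat) (A : affine_map R n N)
    (v : 'rV[R]_n) : 'rV[R]_N :=
  v *m linear_part A + affine_origin A.

Coercion affine_eval : affine_map >-> Funclass.

(* A family over E is given by a total function of (x, r); only its values at
   x in E and r > 0 matter. *)
Definition affine_family (R : realType) (n N : nat) :=
  'rV[R]_n -> R -> affine_map R n N.

Definition compatible (R : realType) (n N : nat) (eps : R) (E : set 'rV[R]_n)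
    (A : affine_family R n N) : Prop :=
  forall (x y : 'rV[R]_n) (r s : R), E x -> E y -> 0 < r -> 0 < s ->
    enorm (x - y) <= Num.max r s ->
    2^-1 <= r / s -> r / s <= 2 ->
    opnorm (linear_part (A x r) - linear_part (A y s)) <=
      eps * Num.min (opnorm (linear_part (A x r)))
                    (opnorm (linear_part (A y s))).

(* Maps defined on a subset X of R^n are given by total functions; only the
   values of f on E, a subset of X, matter. The supremum is taken in the
   extended reals, since the real-valued [sup] of an unbounded set is 0. *)
Definition almost_affine_with (R : realType) (n N : nat) (eps : R)
    (f : 'rV[R]_n -> 'rV[R]_N) (E : set 'rV[R]_n)
    (A : affine_family R n N) : Prop :=
  compatible eps E A /\
  forall (x : 'rV[R]_n) (r : R), E x -> 0 < r ->
    (ereal_sup [set (enorm (f z - A x r z))%:E | z in E `&` cball x r]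
      <= (eps * opnorm (linear_part (A x r)) * r)%:E)%E.

Definition almost_affine (R : realType) (n N : nat) (eps : R)
    (f : 'rV[R]_n -> 'rV[R]_N) (E : set 'rV[R]_n) : Prop :=
  exists A : affine_family R n N, almost_affine_with eps f E A.

(* Main.v *)
Require Import Defs.
From HB Require Import structures.
From mathcomp Require Import all_boot all_order all_algebra.
From mathcomp Require Import all_classical all_reals all_analysis.
From mathcomp Require Import ring lra.
Import Order.TTheory GRing.Theory Num.Theory.
Import numFieldNormedType.Exports.
Local Open Scope classical_set_scope.
Local Open Scope ring_scope.
Set Implicit Arguments.
Unset Strict Implicit.
Unset Printing Implicit Defensive.

(** The extension is Whitney's. Let d be the distance to E and p a choice of
    nearly closest point of E, so that |x - p x| <= 2 d x. Off E, the map at x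
    should look like the affine map W x := A (p x) (d x) attached to the
    nearby point of E at the scale of the distance. These maps jump with the
    choice of p, so they are averaged: F x = sum_i phi_i(x) W(y_i)(x), where
    (phi_i) is a partition of unity of the complement of E such that phi_i is
    Lipschitz with constant of order 1/d and y_i is any point at which the
    index i is active. The new family keeps A (p x) r at the scales r >= d x;
    at a smaller scale it is the affine map with the linear part of W x that
    agrees with F at x.

    Compatibility links A (x, r) to A (y, s) in boundedly many steps when x, y
    are at distance O(r) and r, s are comparable ([near_chain]); the values are
    then also close, because both maps approximate f at the points of the
    chain ([value_chain]). Two points off E sharing an index are in that
    situation, so F x is close to W x x ([extension_center]).

    To pass from the scale d z to a scale r that may be much larger, no bounded
    chain is available. For eps <= 1/2 the slope |A'(x, r)| grows by a factor
    at most 3/2 when r is halved, so r |A'(x, r)| decreases at least by the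
    factor 3/4, and a sum over all dyadic scales between d z and r costs no
    more than a multiple of its largest term ([downscale_linear],
    [downscale_slope]). This yields the estimate at scales r >= d x
    ([extension_large]).

    At scales r < d x / 2 the ball B(x, r) stays at distance of order d x from
    E. There F z - F x - W'(z - x) is a combination of differences of weights,
    of size |z - x| / d x, times differences of affine maps, of size
    eps |W'| d x, plus an average of differences of linear parts; as boundedly
    many indices are involved, it is O(eps |W'| |z - x|) ([extension_small]).

    All constants depend only on n: the number of indices active at a point,
    the Lipschitz constant of the weights, and the power 2 ^+ m that bounds the
    ratios of scales between points sharing an index. *)

(** * Euclidean norm and operator norm *)

Section Norms.
Context {R : realType}.

Lemma enorm_ge0 n (v : 'rV[R]_n) : 0 <= enorm v.
Proof. exact: sqrtr_ge0. Qed.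

Lemma sqr_enorm n (v : 'rV[R]_n) : enorm v ^+ 2 = \sum_(i < n) v ord0 i ^+ 2.
Proof. by rewrite sqr_sqrtr// sumr_ge0// => i _; exact: sqr_ge0. Qed.

Lemma enormZ n (a : R) (v : 'rV[R]_n) : enorm (a *: v) = `|a| * enorm v.
Proof.
rewrite /enorm -sqrtr_sqr -sqrtrM ?sqr_ge0// mulr_sumr.
by congr Num.sqrt; apply: eq_bigr => i _; rewrite mxE exprMn.
Qed.

Lemma enorm0 n : enorm (0 : 'rV[R]_n) = 0.
Proof. by rewrite -(scale0r 0) enormZ normr0 mul0r. Qed.

Lemma enormN n (v : 'rV[R]_n) : enorm (- v) = enorm v.
Proof. by rewrite -scaleN1r enormZ normrN1 mul1r. Qed.

Lemma enormB n (u v : 'rV[R]_n) : enorm (u - v) = enorm (v - u).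
Proof. by rewrite -enormN opprB. Qed.

Lemma coord_le_enorm n (v : 'rV[R]_n) i : `|v ord0 i| <= enorm v.
Proof.
rewrite -sqrtr_sqr ler_wsqrtr// (bigD1 i)//= lerDl sumr_ge0// => j _.
exact: sqr_ge0.
Qed.

Lemma enorm_le_coord n (v : 'rV[R]_n) c :
  (forall i, `|v ord0 i| <= c) -> 0 <= c -> enorm v <= n%:R * c.
Proof.
move=> vc c0; rewrite -(@ler_sqr _ (enorm v)) ?nnegrE ?enorm_ge0 ?mulr_ge0//.
rewrite sqr_enorm; apply: (@le_trans _ _ (\sum_(i < n) c ^+ 2)).
  apply: ler_sum => i _; rewrite -real_normK ?num_real//.
  by rewrite ler_pXn2r ?nnegrE.
rewrite sumr_const card_ord -[c ^+ 2 *+ n]mulr_natl exprMn.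
rewrite ler_wpM2r ?sqr_ge0// -natrX ler_nat.
by case: n {v vc} => // n; rewrite leq_pmulr.
Qed.

Lemma enorm_eq0 n (v : 'rV[R]_n) : enorm v <= 0 -> v = 0.
Proof.
move=> v0; apply/rowP => i; rewrite mxE; apply/eqP; rewrite -normr_le0.
exact: le_trans (coord_le_enorm v i) v0.
Qed.

(** Cauchy-Schwarz: twice the product of |u||v| with the left-hand side is
    compared termwise, using 0 <= (|v| u_i - |u| v_i)^2. *)
Lemma dot_le_enorm n (u v : 'rV[R]_n) :
  \sum_(i < n) u ord0 i * v ord0 i <= enorm u * enorm v.
Proof.
have [/eqP u0|u0] := eqVneq (enorm u) 0.
  have -> : u = 0 by apply: enorm_eq0; rewrite (eqP u0).
  by rewrite enorm0 mul0r big1// => i _; rewrite mxE mul0r.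
have [/eqP v0|v0] := eqVneq (enorm v) 0.
  have -> : v = 0 by apply: enorm_eq0; rewrite (eqP v0).
  by rewrite enorm0 mulr0 big1// => i _; rewrite mxE mulr0.
have up : 0 < enorm u by rewrite lt0r u0 enorm_ge0.
have vp : 0 < enorm v by rewrite lt0r v0 enorm_ge0.
rewrite -(@ler_pM2l _ (enorm u * enorm v *+ 2)) ?pmulrn_lgt0 ?mulr_gt0//.
have -> : enorm u * enorm v *+ 2 * (enorm u * enorm v) =
  \sum_(i < n) (enorm v ^+ 2 * u ord0 i ^+ 2 + enorm u ^+ 2 * v ord0 i ^+ 2).
  by rewrite big_split/= -!mulr_sumr -!sqr_enorm; ring.
rewrite mulr_sumr; apply: ler_sum => i _.
rewrite -subr_ge0.
have -> : enorm v ^+ 2 * u ord0 i ^+ 2 + enorm u ^+ 2 * v ord0 i ^+ 2 -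
   enorm u * enorm v *+ 2 * (u ord0 i * v ord0 i) =
   (enorm v * u ord0 i - enorm u * v ord0 i) ^+ 2 by ring.
exact: sqr_ge0.
Qed.

Lemma ler_enormD n (u v : 'rV[R]_n) : enorm (u + v) <= enorm u + enorm v.
Proof.
rewrite -(@ler_sqr _ (enorm _)) ?nnegrE ?enorm_ge0 ?addr_ge0 ?enorm_ge0//.
rewrite sqr_enorm sqrrD !sqr_enorm.
have -> : \sum_(i < n) (u + v) ord0 i ^+ 2 = \sum_(i < n) u ord0 i ^+ 2 +
   (\sum_(i < n) u ord0 i * v ord0 i) *+ 2 + \sum_(i < n) v ord0 i ^+ 2.
  rewrite -mulr_natl mulr_sumr -!big_split/=; apply: eq_bigr => i _.
  by rewrite !mxE; ring.
by rewrite lerD2r lerD2l lerMn2r/= dot_le_enorm.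
Qed.

Lemma ler_enormB n (u v : 'rV[R]_n) : enorm (u - v) <= enorm u + enorm v.
Proof. by rewrite (le_trans (ler_enormD _ _))// enormN. Qed.

Lemma enorm_distD n (v u w : 'rV[R]_n) :
  enorm (u - w) <= enorm (u - v) + enorm (v - w).
Proof.
by rewrite (_ : u - w = (u - v) + (v - w)) ?ler_enormD// addrA subrK.
Qed.

Lemma ler_enorm_sum n I (s : seq I) (F : I -> 'rV[R]_n) :
  enorm (\sum_(i <- s) F i) <= \sum_(i <- s) enorm (F i).
Proof.
elim/big_ind2 : _ => [|u a v b ua vb|i _]; rewrite ?enorm0//.
by rewrite (le_trans (ler_enormD _ _))// lerD.
Qed.

Section Operator.
Context {n N : nat}.
Implicit Types (L M : 'M[R]_(n, N)).

Lemma opnorm_nonempty L :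
  [set enorm (v *m L) | v in [set v : 'rV[R]_n | enorm v <= 1]] !=set0.
Proof. by exists (enorm (0 *m L)); exists 0; rewrite //= enorm0. Qed.

Lemma opnorm_le L c :
  (forall v, enorm v <= 1 -> enorm (v *m L) <= c) -> opnorm L <= c.
Proof.
move=> Lc; apply: ge_sup; first exact: opnorm_nonempty.
by move=> _ [v /= v1 <-]; exact: Lc.
Qed.

(** The real supremum is meaningful only for a bounded set; here the sum of
    the norms of the rows bounds it. *)
Lemma opnorm_has_sup L :
  has_sup [set enorm (v *m L) | v in [set v : 'rV[R]_n | enorm v <= 1]].
Proof.
split; first exact: opnorm_nonempty.
exists (\sum_(i < n) enorm (row i L)) => _ [v /= v1 <-].
rewrite mulmx_sum_row (le_trans (ler_enorm_sum _ _))//.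
apply: ler_sum => i _; rewrite enormZ ler_piMl ?enorm_ge0//.
exact: le_trans (coord_le_enorm v i) v1.
Qed.

Lemma opnorm_ge0 L : 0 <= opnorm L.
Proof.
apply: le_trans (enorm_ge0 (0 *m L)) _; apply: ub_le_sup.
  by case: (opnorm_has_sup L).
by exists 0; rewrite //= enorm0.
Qed.

Lemma enorm_mulmx_le L v : enorm (v *m L) <= opnorm L * enorm v.
Proof.
have [v0|v0] := eqVneq (enorm v) 0.
  have -> : v = 0 by apply: enorm_eq0; rewrite v0.
  by rewrite mul0mx !enorm0 mulr0.
have vp : 0 < enorm v by rewrite lt0r v0 enorm_ge0.
rewrite -ler_pdivrMr// -[X in X <= _]mulrC.
have -> : (enorm v)^-1 * enorm (v *m L) = enorm (((enorm v)^-1 *: v) *m L).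
  by rewrite -scalemxAl enormZ ger0_norm// invr_ge0 enorm_ge0.
apply: ub_le_sup; first by case: (opnorm_has_sup L).
exists ((enorm v)^-1 *: v) => //=.
by rewrite enormZ ger0_norm ?invr_ge0 ?enorm_ge0// mulVf.
Qed.

Lemma ler_opnormD L M : opnorm (L + M) <= opnorm L + opnorm M.
Proof.
apply: opnorm_le => v v1; rewrite mulmxDr (le_trans (ler_enormD _ _))// lerD//.
- by rewrite (le_trans (enorm_mulmx_le _ _))// ler_piMr ?opnorm_ge0.
- by rewrite (le_trans (enorm_mulmx_le _ _))// ler_piMr ?opnorm_ge0.
Qed.

Lemma opnormN L : opnorm (- L) = opnorm L.
Proof.
by congr sup; apply/seteqP; split=> _ [v v1 <-]; exists v;
  rewrite // mulmxN enormN.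
Qed.

Lemma opnormB L M : opnorm (L - M) = opnorm (M - L).
Proof. by rewrite -opnormN opprB. Qed.

Lemma opnorm_distD M L K : opnorm (L - K) <= opnorm (L - M) + opnorm (M - K).
Proof.
by rewrite (_ : L - K = (L - M) + (M - K)) ?ler_opnormD// addrA subrK.
Qed.

Lemma opnorm0 : opnorm (0 : 'M[R]_(n, N)) = 0.
Proof.
apply/eqP; rewrite eq_le opnorm_ge0 andbT; apply: opnorm_le => v _.
by rewrite mulmx0 enorm0.
Qed.

Lemma opnorm_le_dist L M : opnorm L <= opnorm M + opnorm (L - M).
Proof. by rewrite -{1}(subrK M L) addrC ler_opnormD. Qed.

End Operator.
End Norms.

(** * Distance to a closed set *)

Section Distance.
Context {R : realType} {n : nat}.

(** The factor 2 leaves room to choose p off E, where d > 0; on E it forces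
    p x = x. *)
Lemma distance_and_projection (E : set 'rV[R]_n) : closed E -> E !=set0 ->
  exists (d : 'rV[R]_n -> R) (p : 'rV[R]_n -> 'rV[R]_n),
  [/\ forall x y, d x <= d y + enorm (x - y),
      forall x, E x -> d x = 0,
      forall x, ~ E x -> 0 < d x,
      forall x, E (p x) &
      forall x, enorm (x - p x) <= 2 * d x].
Proof.
move=> Ecl [q Eq].
pose S x := [set enorm (x - y) | y in E].
pose d x := inf (S x).
have S0 x : S x !=set0 by exists (enorm (x - q)); exists q.
have Slb x : has_lbound (S x).
  by exists 0 => _ [y _ <-]; exact: enorm_ge0.
have Sinf x : has_inf (S x) by split.
have dle x y : E y -> d x <= enorm (x - y).
  by move=> Ey; apply: ge_inf => //; exists y.
have d0 x : 0 <= d x.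
  by apply: lb_le_inf => // _ [y _ <-]; exact: enorm_ge0.
have dlt x e : 0 < e -> exists2 y, E y & enorm (x - y) < d x + e.
  by move=> e0; have [_ [y Ey <-] lt] := inf_adherent e0 (Sinf x); exists y.
have dE x : E x -> d x = 0.
  move=> Ex; apply/eqP; rewrite eq_le d0 andbT.
  by rewrite (le_trans (dle _ _ Ex))// subrr enorm0.
have dpos x : ~ E x -> 0 < d x.
  move=> nEx; rewrite lt_neqAle d0 andbT; apply/eqP => dx0.
  apply: nEx; rewrite [E](closure_id E).1// => B /nbhs_ballP[e /= e0 eB].
  have [y Ey] := dlt x _ e0; rewrite -dx0 add0r => xye.
  exists y; split => //; apply: eB.
  rewrite -ball_normE/=; rewrite /ball_/=.
  apply: le_lt_trans xye; rewrite /Num.norm/= mx_normrE.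
  apply: bigmax_le => [|[i j] _]; first exact: enorm_ge0.
  by rewrite /= (ord1 i); exact: coord_le_enorm.
have /(_ _)/cid-/all_sig[p pP] x : exists y, E y /\ enorm (x - y) <= 2 * d x.
  have [Ex|nEx] := pselect (E x).
    by exists x; rewrite subrr enorm0 mulr_ge0.
  have [y Ey lt] := dlt x _ (dpos _ nEx).
  by exists y; split => //; rewrite (le_trans (ltW lt))// mulr_natl.
exists d, p; split => //.
- move=> x y; rewrite -lerBlDr; apply: lb_le_inf => // _ [z Ez <-].
  by rewrite lerBlDr addrC (le_trans (dle x z Ez))// (enorm_distD y).
- by move=> x; case: (pP x).
- by move=> x; case: (pP x).
Qed.

End Distance.

(** * Tent functions *)

Section Hat.
Context {R : realType}.
Implicit Types (t s : R).

Definition hat t : R := Num.max 0 (1 - `|t|).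

Lemma hat_ge0 t : 0 <= hat t.
Proof. by rewrite le_max lexx. Qed.

Lemma hat_le1 t : hat t <= 1.
Proof. by rewrite ge_max ler01 lerBlDr lerDl normr_ge0. Qed.

Lemma hat_lip t s : `|hat t - hat s| <= `|t - s|.
Proof.
rewrite /hat; have := ler_dist_dist t s.
have := normr_ge0 (t - s); move: `|t - s| `|t| `|s| => c a b c0.
rewrite !ler_norml => /andP[h1 h2].
by case: (leP (1 - a) 0); case: (leP (1 - b) 0); lra.
Qed.

(** The integer translates of the tent function form a partition of unity of
    the line in which only the two integers around t are active at t. *)
Lemma hat_supp t (k : int) : hat (t - k%:~R) != 0 ->
  exists b : bool, k = Num.floor t + b%:Z.
Proof.
move=> h; have lt1 : `|t - k%:~R| < 1.
  rewrite ltNge; apply/negP => ge1; move/eqP: h; apply.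
  by apply/max_idPl; rewrite subr_le0.
move: lt1; rewrite ltr_norml => /andP[lo hi].
have /andP[f1 f2] := floor_itv t.
have lek : (Num.floor t <= k)%R.
  rewrite -ltzD1 -(ltr_int R) rmorphD/=; lra.
have kle : (k <= Num.floor t + 1)%R.
  rewrite -ltzD1 -(ltr_int R) !rmorphD/=; move: f2; rewrite rmorphD/=; lra.
have [->|ne] := eqVneq k (Num.floor t); first by exists false; rewrite addr0.
exists true; apply/eqP; rewrite eq_le kle/= lezD1 lt_neqAle lek andbT.
by rewrite eq_sym.
Qed.

Lemma hat_sum t : \sum_(b : bool) hat (t - (Num.floor t + b%:Z)%:~R) = 1.
Proof.
rewrite big_bool/= !rmorphD/= addr0.
have := floor_itv t; rewrite rmorphD/= => /andP[f1 f2].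
set k := (Num.floor t)%:~R in f1 f2 *.
rewrite /hat ler0_norm ?ger0_norm; [|lra|lra].
by rewrite !max_r; lra.
Qed.

Lemma floor_bool_dist t (b : bool) :
  `|t - (Num.floor t + b%:Z)%:~R| <= 1.
Proof.
rewrite rmorphD/=; have := floor_itv t; rewrite rmorphD/= => /andP[f1 f2].
set k := (Num.floor t)%:~R in f1 f2 *.
by rewrite ler_norml; case: b => /=; lra.
Qed.

Lemma prod_lip n (a b : 'I_n -> R) :
  (forall i, 0 <= a i <= 1) -> (forall i, 0 <= b i <= 1) ->
  `|\prod_i a i - \prod_i b i| <= \sum_i `|a i - b i|.
Proof.
elim: n a b => [|n IH] a b a01 b01; first by rewrite !big_ord0 subrr normr0.
rewrite !big_ord_recl.
set a0 := a ord0; set b0 := b ord0.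
set p := \prod_i a _; set q := \prod_i b _.
have -> : a0 * p - b0 * q = (a0 - b0) * p + b0 * (p - q) by ring.
rewrite (le_trans (ler_normD _ _))// lerD//.
  rewrite normrM ler_piMr// ger0_norm ?prodr_ge0//.
    by apply: Num.Theory.prodr_ile1 => i _.
  by move=> i _; case/andP: (a01 (lift ord0 i)).
have /andP[b0_ge b0_le] := b01 ord0.
rewrite normrM (ger0_norm b0_ge) (@le_trans _ _ `|p - q|)//.
  by rewrite ler_piMl.
by apply: IH.
Qed.

Lemma ln_lip (a b c : R) : 0 < c -> c <= a -> c <= b ->
  `|ln a - ln b| <= `|a - b| / c.
Proof.
move=> c0; wlog ba : a b / b <= a.
  move=> H ca cb; have [/H|/ltW/H] := leP b a; first by exact.
  by rewrite distrC (distrC b); exact.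
move=> ca cb; have b0 : 0 < b by exact: lt_le_trans cb.
have a0 : 0 < a by exact: lt_le_trans ca.
rewrite !ger0_norm ?subr_ge0 ?ler_ln ?posrE//.
rewrite -ln_div ?posrE//.
have -> : a / b = 1 + (a - b) / b by field; rewrite gt_eqF.
apply: (le_trans (le_ln1Dx _)).
  by rewrite (@lt_le_trans _ _ 0)// divr_ge0 ?subr_ge0// ltW.
by rewrite ler_wpM2l ?subr_ge0// lef_pV2 ?posrE.
Qed.

End Hat.

(** * A Whitney partition of unity *)

(** The scale of a weight, as a power of e, and a node of the grid at that
    scale. *)
Definition bump_index (n : nat) := (int * {ffun 'I_n -> int})%type.

Section Partition.
Context {R : realType} {n : nat}.
Variable d : 'rV[R]_n -> R.

(** Grid step at the k-th scale: a power of e rather than of 2, so that the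
    scale of x is read off ln (d x). *)
Definition mesh (k : int) : R := expR k%:~R.

(** A product of tent functions: one in the variable ln d, which selects the
    scale, and one in each coordinate measured in units of that scale. These
    weights add up to 1 without normalization: the grid sum at each scale is 1,
    and so is the sum over the scales. *)
Definition whitney_bump (i : bump_index n) (x : 'rV[R]_n) : R :=
  hat (ln (d x) - i.1%:~R) *
  \prod_j hat (x ord0 j / mesh i.1 - (i.2 j)%:~R).

(** The bits u choose between the integer part and its successor, for the
    scale and for each coordinate. *)
Definition active_index (x : 'rV[R]_n) (u : bool * {ffun 'I_n -> bool}) :
    bump_index n :=
  let k := Num.floor (ln (d x)) + u.1%:Z in
  (k, [ffun j => Num.floor (x ord0 j / mesh k) + (u.2 j)%:Z]).

(** A list containing the finitely many indices whose weight may be nonzero at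
    x; a listed index may still have weight 0, so the metric estimates below
    are proved for all listed indices. *)
Definition active (x : 'rV[R]_n) : seq (bump_index n) :=
  [seq active_index x u | u : bool * {ffun 'I_n -> bool}].

Lemma activeP i x :
  reflect (exists u, i = active_index x u) (i \in active x).
Proof.
apply: (iffP mapP) => -[u]; first by exists u.
by move=> ->; exists u; rewrite ?mem_enum.
Qed.

Lemma size_active x : size (active x) = (2 * 2 ^ n)%N.
Proof. by rewrite size_map -cardE card_prod card_ffun !card_bool card_ord. Qed.

Lemma active_index_inj x : injective (active_index x).
Proof.
have nat_of_bool_int_inj (m : int) (a b : bool) :
    m + a%:Z = m + b%:Z -> a = b.
  by move=> /addrI; case: a; case: b.
move=> [a u] [b v] [/nat_of_bool_int_inj <- /ffunP uv].
congr pair; apply/ffunP => j; have := uv j.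
by rewrite !ffunE => /nat_of_bool_int_inj.
Qed.

Lemma uniq_active x : uniq (active x).
Proof. by rewrite map_inj_uniq ?enum_uniq//; exact: active_index_inj. Qed.

Lemma bump_ge0 i x : 0 <= whitney_bump i x.
Proof.
by rewrite mulr_ge0 ?hat_ge0// prodr_ge0// => j _; exact: hat_ge0.
Qed.

Lemma bump_active i x : i \notin active x -> whitney_bump i x = 0.
Proof.
apply: contraNeq; rewrite mulf_eq0 negb_or => /andP[hk /prodf_neq0 hg].
have [b kE] := hat_supp hk.
have /(_ _)/cid-/all_sig[u uE] j := hat_supp (hg j isT).
apply/activeP; exists (b, [ffun j => u j]).
case: i kE {hk hg} uE => k g /= -> uE; congr pair; apply/ffunP => j.
by rewrite !ffunE uE.
Qed.

(** For a fixed scale the sum over the grid of a product over coordinates is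
    the product over coordinates of sums equal to 1. *)
Lemma sum_bump_active x : \sum_(i <- active x) whitney_bump i x = 1.
Proof.
rewrite big_map big_enum/=.
transitivity (\sum_(b : bool) \sum_(v : {ffun 'I_n -> bool})
    whitney_bump (active_index x (b, v)) x).
  by rewrite pair_bigA/=; apply: eq_bigr => -[].
rewrite -[RHS](hat_sum (ln (d x))); apply: eq_bigr => b _.
rewrite /whitney_bump /= -mulr_sumr -[RHS]mulr1; congr (_ * _).
set k := Num.floor _ + _.
transitivity (\sum_(v : {ffun 'I_n -> bool}) \prod_j
    hat (x ord0 j / mesh k - (Num.floor (x ord0 j / mesh k) + (v j)%:Z)%:~R)).
  by apply: eq_bigr => v _; apply: eq_bigr => j _; rewrite /= ffunE.
rewrite -(bigA_distr_bigA (fun j (b : bool) =>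
  hat (x ord0 j / mesh k - (Num.floor (x ord0 j / mesh k) + b%:Z)%:~R))).
by rewrite big1// => j _; exact: hat_sum.
Qed.

Lemma mesh_gt0 k : 0 < mesh k.
Proof. exact: expR_gt0. Qed.

Lemma active_mesh i x : 0 < d x -> i \in active x ->
  mesh i.1 <= expR 1 * d x /\ d x <= expR 1 * mesh i.1.
Proof.
move=> dx /activeP[u ->] /=.
have := floor_bool_dist (ln (d x)) u.1.
set k := Num.floor _ + _; rewrite ler_norml => /andP[h1 h2].
rewrite -{1 2}(lnK (x := d x)) ?posrE// /mesh -!expRD !ler_expR; split; lra.
Qed.

Lemma active_grid i x j : i \in active x ->
  `|x ord0 j - (i.2 j)%:~R * mesh i.1| <= mesh i.1.
Proof.
move=> /activeP[u ->]; set m := mesh _.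
have m0 : 0 < m by exact: mesh_gt0.
have -> : (active_index x u).2 j = Num.floor (x ord0 j / m) + (u.2 j)%:Z.
  by rewrite ffunE.
set g := (_ + _)%:~R.
have -> : x ord0 j - g * m = (x ord0 j / m - g) * m.
  by rewrite mulrBl divfK// gt_eqF.
rewrite normrM (gtr0_norm m0) ler_piMl ?(ltW m0)//.
exact: floor_bool_dist.
Qed.

(** Both points are within one grid step of the same node, and that step is
    comparable to each of the two distances. *)
Lemma active_near i x y : 0 < d x -> 0 < d y ->
  i \in active x -> i \in active y ->
  enorm (x - y) <= 2 * n%:R * expR 1 * d x /\ d y <= expR 1 ^+ 2 * d x.
Proof.
move=> dx dy ix iy; have [mx _] := active_mesh dx ix.
have [_ my] := active_mesh dy iy; have m0 := mesh_gt0 i.1; split; last first.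
  by rewrite (le_trans my)// expr2 -mulrA ler_wpM2l ?expR_ge0.
rewrite (@le_trans _ _ (n%:R * (2 * mesh i.1)))//; last first.
  rewrite -!mulrA mulrCA ler_wpM2l// ler_wpM2l ?ler0n//.
apply: enorm_le_coord => [j|]; last by rewrite mulr_ge0// ltW.
rewrite !mxE (le_trans (ler_distD ((i.2 j)%:~R * mesh i.1) _ _))//.
rewrite mulr_natl mulr2n lerD ?active_grid//.
by rewrite distrC active_grid.
Qed.

Hypothesis d_lip : forall x y, d x <= d y + enorm (x - y).

(** A weight is a product of n + 1 factors with values in [0, 1], so the
    increments of the factors add up: ln d is 1/min d-Lipschitz because d is
    1-Lipschitz, and each coordinate factor varies at rate 1/mesh. *)
Lemma bump_lip i x z : 0 < d x -> 0 < d z -> i \in active x ->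
  `|whitney_bump i x - whitney_bump i z| <=
    (1 + n%:R * expR 1) * enorm (x - z) / Num.min (d x) (d z).
Proof.
move=> dx dz ix; set c := Num.min _ _; set e := enorm _.
have c0 : 0 < c by rewrite lt_min dx.
have e0 : 0 <= e by exact: enorm_ge0.
have [_ mx] := active_mesh dx ix; have m0 := mesh_gt0 i.1.
have cm : c <= expR 1 * mesh i.1 by rewrite (le_trans _ mx)// ge_min lexx.
(* The scale factor is made the factor of index 0 of a single product. *)
pose F (y : 'rV[R]_n) (j : 'I_n.+1) := if unlift ord0 j is Some j'
  then hat (y ord0 j' / mesh i.1 - (i.2 j')%:~R)
  else hat (ln (d y) - i.1%:~R).
have FE y : whitney_bump i y = \prod_j F y j.
  rewrite big_ord_recl /F unlift_none; congr (_ * _).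
  by apply: eq_bigr => j _; rewrite liftK.
have F01 y j : 0 <= F y j <= 1.
  by rewrite /F; case: unlift => [?|]; rewrite hat_ge0 hat_le1.
rewrite !FE (le_trans (prod_lip (F01 x) (F01 z)))// big_ord_recl.
rewrite !mulrDl mul1r; apply: lerD.
  rewrite /F unlift_none (le_trans (hat_lip _ _))// opprB addrA addrNK.
  rewrite (le_trans (ln_lip c0 _ _))// ?ge_min ?lexx ?orbT//.
  rewrite ler_wpM2r ?invr_ge0 ?(ltW c0)// ler_norml.
  have := d_lip x z; have := d_lip z x; rewrite enormB -/e.
  by move=> *; apply/andP; split; lra.
rewrite (@le_trans _ _ (\sum_(j < n) (expR 1 * e / c)))//; last first.
  by rewrite sumr_const card_ord -[_ *+ n]mulr_natl !mulrA.
apply: ler_sum => j _; rewrite /F liftK (le_trans (hat_lip _ _))//.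
rewrite opprB addrA addrNK -mulrBl normrM (gtr0_norm (x := _^-1)) ?invr_gt0//.
rewrite ler_pdivrMr// mulrAC ler_pdivlMr// mulrC [leRHS]mulrAC.
apply: ler_pM => //; first exact: ltW.
by have := coord_le_enorm (x - z) j; rewrite !mxE.
Qed.

End Partition.

(** * Chains of compatible linear maps *)

Section Near.
Context {R : realType} {n N : nat}.
Implicit Types (L M K : 'M[R]_(n, N)) (A B : affine_map R n N).

Definition near_maps (c : R) L M : Prop :=
  opnorm (L - M) <= c * Num.min (opnorm L) (opnorm M).

Lemma near_mapsC c L M : near_maps c L M -> near_maps c M L.
Proof. by rewrite /near_maps opnormB minC. Qed.

Lemma near_maps_le c c' L M : c <= c' -> near_maps c L M -> near_maps c' L M.
Proof.
move=> cc' /le_trans; apply; rewrite ler_wpM2r//.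
by rewrite le_min !opnorm_ge0.
Qed.

Lemma near_maps_l c L M : 0 <= c -> near_maps c L M ->
  opnorm (L - M) <= c * opnorm L.
Proof.
by move=> c0 /le_trans; apply; rewrite ler_wpM2l// ge_min lexx.
Qed.

Lemma near_maps_opnorm c L M : 0 <= c -> near_maps c L M ->
  opnorm M <= (1 + c) * opnorm L.
Proof.
move=> c0 /(near_maps_l c0); have := opnorm_le_dist M L.
by rewrite opnormB; lra.
Qed.

(** Composing relative errors a e and b e gives a + b + a b e, which is at most
    3 a b when a, b >= 1 and e <= 1; in product form the bound iterates without
    bookkeeping. *)
Lemma near_maps_trans a b e L M K : 1 <= a -> 1 <= b -> 0 <= e <= 1 ->
  near_maps (a * e) L M -> near_maps (b * e) M K ->
  near_maps (3 * a * b * e) L K.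
Proof.
move=> a1 b1 /andP[e0 e1]; wlog suff H : a b L K a1 b1 /
    near_maps (a * e) L M -> near_maps (b * e) M K ->
    opnorm (L - K) <= 3 * a * b * e * opnorm L.
  move=> LM MK; have c0 : 0 <= 3 * a * b * e by rewrite !mulr_ge0//; lra.
  rewrite /near_maps minr_pMr// le_min H//=.
  rewrite opnormB (_ : 3 * a * b = 3 * b * a); last by ring.
  by apply: H => //; exact: near_mapsC.
move=> LM MK; have ae0 : 0 <= a * e by rewrite mulr_ge0//; lra.
have be0 : 0 <= b * e by rewrite mulr_ge0//; lra.
have h1 := near_maps_l ae0 LM; have h2 := near_maps_l be0 MK.
have h3 := near_maps_opnorm ae0 LM; have h4 := opnorm_distD M L K.
apply: (le_trans h4); apply: (le_trans (lerD h1 (le_trans h2 _))).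
  exact: ler_wpM2l be0 _ _ h3.
have := opnorm_ge0 L; move: (opnorm L) => l l0.
have -> : a * e * l + b * e * ((1 + a * e) * l) =
  (a + b + (a * b) * e) * (e * l) by ring.
have -> : 3 * a * b * e * l = 3 * a * b * (e * l) by ring.
apply: ler_wpM2r; first exact: mulr_ge0.
have : a * b * e <= a * b by rewrite ler_piMr// mulr_ge0//; lra.
have : 0 <= (a - 1) * (b - 1) by rewrite mulr_ge0//; lra.
have : a <= a * b by rewrite ler_peMr//; lra.
have : b <= a * b by rewrite ler_peMl//; lra.
lra.
Qed.

Lemma affine_eval_diff A x z :
  A z = A x + (z - x) *m linear_part A.
Proof. by rewrite /affine_eval mulmxBl [RHS]addrC addrA subrK. Qed.

Lemma affine_dist_le A B x z : enorm (A z - B z) <= enorm (A x - B x) +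
  opnorm (linear_part A - linear_part B) * enorm (z - x).
Proof.
rewrite (affine_eval_diff A x z) (affine_eval_diff B x z) opprD addrACA.
rewrite -mulmxBr (le_trans (ler_enormD _ _))// lerD2l.
exact: enorm_mulmx_le.
Qed.

End Near.

Lemma ex_exp2_ge (R : realType) (x : R) : exists m : nat, x <= 2 ^+ m.
Proof.
exists (Num.truncn x).+1; rewrite (le_trans (ltW (truncnS_gt x)))//.
by rewrite -natrX ler_nat ltnW// ltn_expl.
Qed.

(** * Almost affine maps at different points and scales *)

Section Family.
Context {R : realType} {n N : nat}.
Variables (E : set 'rV[R]_n) (f : 'rV[R]_n -> 'rV[R]_N).
Variables (A : affine_family R n N) (eps : R).
Hypothesis eps_ge0 : 0 <= eps.
Hypothesis eps_le : eps <= 2^-1.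
Hypothesis fA : almost_affine_with eps f E A.

Local Notation slope x r := (opnorm (linear_part (A x r))).

Lemma slope_ge0 x r : 0 <= slope x r. Proof. exact: opnorm_ge0. Qed.

Lemma eps_01 : 0 <= eps <= 1.
Proof. by rewrite eps_ge0/=; move: eps_le; lra. Qed.

Lemma compatible_near x y r s : E x -> E y -> 0 < r -> 0 < s ->
  enorm (x - y) <= Num.max r s -> r <= 2 * s -> s <= 2 * r ->
  near_maps eps (linear_part (A x r)) (linear_part (A y s)).
Proof.
move=> Ex Ey r0 s0 xy rs sr; apply: fA.1 => //.
  by rewrite ler_pdivlMr//; lra.
by rewrite ler_pdivrMr.
Qed.

Lemma almost_affine_le x r z : E x -> E z -> 0 < r -> enorm (z - x) <= r ->
  enorm (f z - A x r z) <= eps * slope x r * r.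
Proof.
move=> Ex Ez r0 zx; rewrite -lee_fin; apply: le_trans (fA.2 _ _ Ex r0).
by apply: ereal_sup_ubound; exists z.
Qed.

Lemma near_rescale m x s r : E x -> 0 < s -> s <= r -> r <= 2 ^+ m * s ->
  near_maps (3 ^+ m * eps) (linear_part (A x s)) (linear_part (A x r)).
Proof.
move=> Ex s0; elim: m r => [|m IH] r sr rs.
  rewrite expr0 mul1r; apply: compatible_near => //; try lra.
  by rewrite subrr enorm0 le_max; apply/orP; left; lra.
have r0 : 0 < r by lra.
have p1 : 1 <= 3 ^+ m :> R by rewrite exprn_ege1//; lra.
have [r2|r2] := leP r (2 * s).
  apply: (@near_maps_le _ _ _ eps).
    by rewrite ler_peMl// exprn_ege1//; lra.
  apply: compatible_near => //; try lra.
  by rewrite subrr enorm0 le_max; apply/orP; left; lra.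
rewrite exprS -[X in X * eps]mulr1.
apply: (near_maps_trans (M := linear_part (A x (r / 2)))) => //.
- exact: eps_01.
- apply: IH; first lra.
  by move: rs; rewrite exprS -mulrA; lra.
- rewrite mul1r; apply: compatible_near => //; try lra.
  by rewrite subrr enorm0 le_max; apply/orP; left; lra.
Qed.

Definition chain_const (m : nat) : R := 3 ^+ (3 * m + 2).

Lemma chain_const_ge1 m : 1 <= chain_const m.
Proof. by rewrite exprn_ege1//; lra. Qed.

(** The chain climbs from r to the scale 2 ^+ m * r, which dominates |x - y|,
    moves from x to y in one step there, and goes down to s. *)
Lemma near_chain m x y r s : E x -> E y -> 0 < r -> 0 < s ->
  enorm (x - y) <= 2 ^+ m * r -> r <= 2 ^+ m * s -> s <= 2 ^+ m * r ->
  near_maps (chain_const m * eps)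
    (linear_part (A x r)) (linear_part (A y s)).
Proof.
move=> Ex Ey r0 s0 xy rs sr; set P := 2 ^+ m * r.
have T1 : 1 <= 2 ^+ m :> R by rewrite exprn_ege1//; lra.
have rP : r <= P by rewrite ler_peMl// ltW.
have P0 : 0 < P by lra.
have p1 k : 1 <= 3 ^+ k :> R by rewrite exprn_ege1//; lra.
have -> : chain_const m = 3 * (3 * 3 ^+ m * 1) * 3 ^+ (m + m).
  rewrite /chain_const (_ : (3 * m + 2 = m + (m + m) + 2)%N) ?exprD; first ring.
  by rewrite !mulSn mul0n addn0.
apply: (near_maps_trans (M := linear_part (A y P))) => //.
- by have := p1 m; lra.
- exact: eps_01.
- apply: (near_maps_trans (M := linear_part (A x P))) => //.
  + exact: eps_01.
  + by apply: near_rescale.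
  + rewrite mul1r; apply: compatible_near => //; try lra.
    by rewrite le_max xy.
apply: near_mapsC; apply: near_rescale => //.
by rewrite exprD -mulrA /P ler_wpM2l//; lra.
Qed.

Definition value_const (m : nat) : R :=
  1 + (2 + 3 * 3 ^+ m) * 2 ^+ m + (1 + chain_const m) * 2 ^+ m
    + 2 * (3 ^+ m + chain_const m) * 2 ^+ m.

Lemma value_const_ge0 m : 0 <= value_const m.
Proof.
have T1 : 1 <= 2 ^+ m :> R by rewrite exprn_ege1//; lra.
have P1 : 1 <= 3 ^+ m :> R by rewrite exprn_ege1//; lra.
by have K1 := chain_const_ge1 m; rewrite !addr_ge0 ?mulr_ge0//; lra.
Qed.

(** Closeness of linear parts gives closeness of values once the values agree
    approximately at one point. For the same centre x this point is x, where
    both maps approximate f x; for the same large scale it is y, which lies in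
    the ball of radius 2 ^+ m * r around x. *)
Lemma value_chain m x y r s z : E x -> E y -> 0 < r -> 0 < s ->
  enorm (x - y) <= 2 ^+ m * r -> r <= 2 ^+ m * s -> s <= 2 ^+ m * r ->
  enorm (z - x) <= 2 ^+ m * r ->
  enorm (A x r z - A y s z) <= value_const m * (eps * slope x r * r).
Proof.
move=> Ex Ey r0 s0 xy rs sr zx.
have T1 : 1 <= 2 ^+ m :> R by rewrite exprn_ege1//; lra.
have P1 : 1 <= 3 ^+ m :> R by rewrite exprn_ege1//; lra.
have K1 := chain_const_ge1 m.
set P := 2 ^+ m * r; have rP : r <= P by rewrite ler_peMl// ltW.
have P0 : 0 < P by lra.
have nK := near_chain Ex Ey r0 s0 xy rs sr.
have nP := near_rescale Ex r0 rP (lexx P).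
have c0 : 0 <= 3 ^+ m * eps by rewrite mulr_ge0//; lra.
have k0 : 0 <= chain_const m * eps by rewrite mulr_ge0//; lra.
have slopeP := near_maps_opnorm c0 nP.
have slopes := near_maps_opnorm k0 nK.
have linP := near_maps_l c0 nP; have linK := near_maps_l k0 nK.
have e1 : eps <= 1 by case/andP: eps_01.
move: (slope_ge0 x r) => mu0.
have {}slopeP : slope x P <= (1 + 3 ^+ m) * slope x r.
  apply: (le_trans slopeP); rewrite ler_wpM2r// lerD2l ler_piMr//; lra.
have {}slopes : slope y s <= (1 + chain_const m) * slope x r.
  apply: (le_trans slopes); rewrite ler_wpM2r// lerD2l ler_piMr//; lra.
have zy : enorm (z - y) <= 2 * P.
  by rewrite (le_trans (enorm_distD x _ _))// mulr2n mulrDl !mul1r lerD.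
have atx : enorm (A x r x - A x P x) <=
    eps * slope x r * r + eps * ((1 + 3 ^+ m) * slope x r) * P.
  rewrite (le_trans (enorm_distD (f x) _ _))// enormB lerD//.
    by apply: almost_affine_le => //; rewrite subrr enorm0 ltW.
  apply: (le_trans (almost_affine_le Ex Ex P0 _)).
    by rewrite subrr enorm0 ltW.
  by rewrite ler_wpM2r ?(ltW P0)// ler_wpM2l.
have aty : enorm (A x P y - A y s y) <=
    eps * ((1 + 3 ^+ m) * slope x r) * P +
    eps * ((1 + chain_const m) * slope x r) * P.
  rewrite (le_trans (enorm_distD (f y) _ _))// enormB lerD//.
    apply: (le_trans (almost_affine_le Ex Ey P0 _)).
      by rewrite enormB.
    by rewrite ler_wpM2r ?(ltW P0)// ler_wpM2l.
  apply: (le_trans (almost_affine_le Ey Ey s0 _)).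
    by rewrite subrr enorm0 ltW.
  apply: ler_pM => //; rewrite ?mulr_ge0 ?slope_ge0 ?ler_wpM2l//; exact: ltW.
have lin1 : opnorm (linear_part (A x r) - linear_part (A x P)) * enorm (z - x)
    <= 3 ^+ m * eps * slope x r * P.
  by apply: ler_pM => //; rewrite ?opnorm_ge0 ?enorm_ge0.
have lin2 : opnorm (linear_part (A x P) - linear_part (A y s)) * enorm (z - y)
    <= (3 ^+ m * eps * slope x r + chain_const m * eps * slope x r) * (2 * P).
  apply: ler_pM => //; rewrite ?opnorm_ge0 ?enorm_ge0//.
  rewrite (le_trans (opnorm_distD (linear_part (A x r)) _ _))// opnormB.
  exact: lerD.
have := affine_dist_le (A x r) (A x P) x z.
have := affine_dist_le (A x P) (A y s) y z.
have := enorm_distD (A x P z) (A x r z) (A y s z).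
rewrite /value_const; move: atx aty lin1 lin2; rewrite /P.
lra.
Qed.

(** Each halving of the scale adds an error eps |A'(x, r)|, multiplied by the
    small radius s. With D for the left-hand side relative to eps |A'(x, r)| r,
    one doubling gives D <= (3/4) D + 1/2, whose fixed point is the constant
    2: the bound does not depend on the number of scales between s and r. *)
Lemma downscale_linear x s r : E x -> 0 < s -> s <= r ->
  opnorm (linear_part (A x s) - linear_part (A x r)) * s <=
    2 * (eps * slope x r * r).
Proof.
move=> Ex s0; have [m] := ex_exp2_ge (r / s).
rewrite ler_pdivrMr//; elim: m r => [|m IH] r rs sr.
  have -> : r = s by move: rs; rewrite expr0 mul1r => ?; lra.
  by rewrite subrr opnorm0 mul0r !mulr_ge0// ?slope_ge0// ltW.
have r0 : 0 < r by lra.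
have [r2|r2] := leP r (2 * s).
  have := @compatible_near x x s r Ex Ex s0 r0.
  rewrite subrr enorm0 le_max ltW//= => /(_ isT) h.
  have {h}/near_mapsC/(near_maps_l eps_ge0) : near_maps eps
    (linear_part (A x s)) (linear_part (A x r)) by apply: h; lra.
  rewrite opnormB -(ler_pM2r s0) => h; apply: (le_trans h).
  have := slope_ge0 x r; move: (slope x r) => u u0.
  have eu0 : 0 <= eps * u by exact: mulr_ge0.
  have : eps * u * s <= eps * u * r by exact: ler_wpM2l.
  have : 0 <= eps * u * r by rewrite mulr_ge0// ltW.
  lra.
have t0 : 0 < r / 2 by lra.
have : opnorm (linear_part (A x s) - linear_part (A x (r / 2))) * s <=
    2 * (eps * slope x (r / 2) * (r / 2)).
  apply: IH; last lra.
  by move: rs; rewrite exprS -mulrA; lra.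
have nr : near_maps eps (linear_part (A x r)) (linear_part (A x (r / 2))).
  apply: compatible_near => //; try lra.
  by rewrite subrr enorm0 le_max ltW.
have := near_maps_l eps_ge0 nr; have := near_maps_opnorm eps_ge0 nr.
have := opnorm_distD (linear_part (A x (r / 2))) (linear_part (A x s))
  (linear_part (A x r)).
rewrite (opnormB (linear_part (A x (r / 2)))).
set a := opnorm (_ - _); set b := opnorm (_ - _); set c := opnorm (_ - _).
have := slope_ge0 x r; set u := slope x r; set v := slope x (r / 2) => u0.
move=> h1 h2 h3 h4.
have h5 : v <= 3 / 2 * u.
  by apply: (le_trans h2); rewrite ler_wpM2r//; move: eps_le; lra.
have h6 : eps * v * r <= eps * (3 / 2 * u) * r.
  by rewrite ler_wpM2r ?ler_wpM2l// ltW.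
have h7 : a * s <= (b + c) * s by rewrite ler_wpM2r// ltW.
have h8 : c * s <= eps * u * (r / 2).
  apply: ler_pM => //; [exact: opnorm_ge0|exact: ltW|lra].
lra.
Qed.

Lemma downscale_slope x s r : E x -> 0 < s -> s <= r ->
  slope x s * s <= 2 * (slope x r * r).
Proof.
move=> Ex s0 sr; have h1 := downscale_linear Ex s0 sr.
have h2 : slope x s * s <= (slope x r +
    opnorm (linear_part (A x s) - linear_part (A x r))) * s.
  by rewrite ler_wpM2r ?opnorm_le_dist// ltW.
have h3 : slope x r * s <= slope x r * r by rewrite ler_wpM2l ?slope_ge0.
have h4 : eps * (slope x r * r) <= 2^-1 * (slope x r * r).
  by rewrite ler_wpM2r// mulr_ge0 ?slope_ge0//; lra.
lra.
Qed.

Lemma downscale_value x s r z : E x -> 0 < s -> s <= r ->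
  enorm (z - x) <= 2 * s ->
  enorm (A x s z - A x r z) <= 7 * (eps * slope x r * r).
Proof.
move=> Ex s0 sr zx; have r0 : 0 < r by lra.
have := affine_dist_le (A x s) (A x r) x z.
have := enorm_distD (f x) (A x s x) (A x r x); rewrite (enormB _ (f x)).
have self t : 0 < t -> enorm (f x - A x t x) <= eps * slope x t * t.
  by move=> t0; apply: almost_affine_le => //; rewrite subrr enorm0 ltW.
have := self _ s0; have := self _ r0.
have h : eps * (slope x s * s) <= eps * (2 * (slope x r * r)).
  by rewrite ler_wpM2l// downscale_slope.
have h' : opnorm (linear_part (A x s) - linear_part (A x r)) * enorm (z - x)
  <= opnorm (linear_part (A x s) - linear_part (A x r)) * (2 * s).
  by rewrite ler_wpM2l// opnorm_ge0.
have := downscale_linear Ex s0 sr.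
lra.
Qed.

End Family.

(** * The extension *)

Lemma big_uniq_support (V : nmodType) (I : eqType) (s t : seq I) (F : I -> V) :
  uniq s -> uniq t -> {subset s <= t} -> (forall i, i \notin s -> F i = 0) ->
  \sum_(i <- s) F i = \sum_(i <- t) F i.
Proof.
move=> us ut st F0; rewrite [RHS](bigID (mem s))/= [X in _ + X]big1// addr0.
rewrite -[RHS]big_filter; apply: perm_big; apply: uniq_perm => //.
  exact: filter_uniq.
move=> i; rewrite mem_filter/=.
by case: (boolP (i \in s)) => // /st ->.
Qed.

Section Extension.
Context {R : realType} {n N : nat}.
Variables (E : set 'rV[R]_n) (f : 'rV[R]_n -> 'rV[R]_N).
Variables (A : affine_family R n N) (eps : R).
Hypothesis eps_ge0 : 0 <= eps.
Hypothesis eps_le : eps <= 2^-1.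
Hypothesis fA : almost_affine_with eps f E A.
Variables (d : 'rV[R]_n -> R) (p : 'rV[R]_n -> 'rV[R]_n).
Hypothesis d_lip : forall x y, d x <= d y + enorm (x - y).
Hypothesis d_eq0 : forall x, E x -> d x = 0.
Hypothesis d_gt0 : forall x, ~ E x -> 0 < d x.
Hypothesis pE : forall x, E (p x).
Hypothesis p_dist : forall x : 'rV[R]_n, enorm (x - p x) <= 2 * d x.
Variable m : nat.
(* If y is active at an index of a point z with |z - x| <= d x / 2, then
   d y <= 2 e^2 d x and |z - y| <= 4 n e d x, whence
   |p x - p y| <= (4 e^2 + 4 n e + 3) d x. The constant 6 instead of 3 makes the
   bound at least 10, enough for all the comparisons at scales r >= d x. *)
Hypothesis m_large : 4 * expR 1 ^+ 2 + 4 * n%:R * expR 1 + 6 <= 2 ^+ m :> R.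

Local Notation slope x r := (opnorm (linear_part (A x r))).

Definition whitney_map x : affine_map R n N := A (p x) (d x).

(** A point where the index i is active: defining the affine map of i through
    such a point reduces every comparison to two points sharing an index. The
    default 0 of the choice is reached only by indices active nowhere off E. *)
Definition index_point (i : bump_index n) : 'rV[R]_n :=
  xget 0 [set y | ~ E y /\ i \in active d y].

Definition extension (x : 'rV[R]_n) : 'rV[R]_N :=
  if `[< E x >] then f x
  else \sum_(i <- active d x)
    whitney_bump d i x *: whitney_map (index_point i) x.

(** In both cases the linear part is that of A (p x) (max r (d x)), so
    compatibility of the extended family is an instance of [near_chain]. *)
Definition extended_family : affine_family R n N := fun x r =>
  if d x <= r then A (p x) r else
  let L := linear_part (whitney_map x) in AffineMap L (extension x - x *m L).

Lemma index_pointP i x : ~ E x -> i \in active d x ->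
  ~ E (index_point i) /\ i \in active d (index_point i).
Proof. by move=> Ex ix; rewrite /index_point; case: xgetP => // /(_ x)[]. Qed.

Lemma d_ge0 x : 0 <= d x.
Proof.
by have [Ex|/d_gt0/ltW//] := pselect (E x); rewrite d_eq0.
Qed.

Lemma p_id x : E x -> p x = x.
Proof.
move=> Ex; have := p_dist x; rewrite d_eq0// mulr0 => /enorm_eq0.
by move/eqP; rewrite subr_eq0 => /eqP.
Qed.

Lemma p_dist2 x y : enorm (p x - p y) <= 2 * d x + enorm (x - y) + 2 * d y.
Proof.
rewrite (le_trans (enorm_distD x _ _))// enormB -addrA lerD//.
by rewrite (le_trans (enorm_distD y _ _))// lerD.
Qed.

Lemma expR1_ge1 : 1 <= expR 1 :> R.
Proof. by have := expR_ge1Dx (1 : R); lra. Qed.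

Lemma exp2m_ge10 : 10 <= 2 ^+ m :> R.
Proof.
apply: le_trans m_large; have e1 := expR1_ge1.
have : 1 <= expR 1 ^+ 2 :> R by rewrite exprn_ege1.
have : 0 <= n%:R * expR 1 :> R by rewrite mulr_ge0.
lra.
Qed.

(** In this section z is in the ball of radius d x / 2 around x, so the whole
    ball keeps a distance from E comparable to d x, and i is active at z. With
    z = x this covers the indices active at x itself. *)
Section Local.
Variables (x z : 'rV[R]_n) (i : bump_index n).
Hypothesis nEx : ~ E x.
Hypothesis zx : enorm (z - x) <= d x / 2.
Hypothesis iz : i \in active d z.

Lemma half_ball_d : d x / 2 <= d z <= 2 * d x.
Proof.
have := d_lip x z; have := d_lip z x; rewrite (enormB x z) => h1 h2.
by have := d_gt0 nEx; move: zx => *; apply/andP; split; lra.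
Qed.

Lemma half_notin : ~ E z.
Proof.
by move=> /d_eq0; have := half_ball_d; have := d_gt0 nEx; lra.
Qed.

Let y := index_point i.

Lemma index_point_scale : [/\ ~ E y, 0 < d y,
  enorm (p x - p y) <= 2 ^+ m * d x,
  d x <= 2 ^+ m * d y & d y <= 2 ^+ m * d x].
Proof.
have [nEy iy] := index_pointP half_notin iz; rewrite -/y in nEy iy.
have dy := d_gt0 nEy; have dz := d_gt0 half_notin; have dx := d_gt0 nEx.
have [zy dyz] := active_near dz dy iz iy.
have [_ dzy] := active_near dy dz iy iz.
have /andP[d1 d2] := half_ball_d.
have e1 := expR1_ge1; have mL := m_large.
set e := expR 1 in e1 zy dyz dzy mL *.
have ee : 1 <= e ^+ 2 by rewrite exprn_ege1.
have ne : 0 <= n%:R * e by rewrite mulr_ge0//; lra.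
have h1 : d y <= 2 * e ^+ 2 * d x.
  have : e ^+ 2 * d z <= e ^+ 2 * (2 * d x) by rewrite ler_wpM2l//; lra.
  lra.
have h2 : d x <= 2 * e ^+ 2 * d y by lra.
have h3 : enorm (z - y) <= 4 * n%:R * e * d x.
  rewrite (le_trans zy)//.
  have : n%:R * e * d z <= n%:R * e * (2 * d x) by rewrite ler_wpM2l.
  lra.
have h4 := p_dist2 x y.
have h5 := enorm_distD z x y; rewrite (enormB x z) in h5.
have h6 : (4 * e ^+ 2 + 4 * n%:R * e + 6) * d x <= 2 ^+ m * d x.
  by rewrite ler_wpM2r// ltW.
have h7 : (4 * e ^+ 2 + 4 * n%:R * e + 6) * d y <= 2 ^+ m * d y.
  by rewrite ler_wpM2r// ltW.
have h8 : 0 <= n%:R * e * d y by rewrite mulr_ge0// ltW.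
have h9 : 0 <= n%:R * e * d x by rewrite mulr_ge0// ltW.
have h10 : 0 <= e ^+ 2 * d x by rewrite mulr_ge0 ?ltW//; lra.
have h11 : 0 <= e ^+ 2 * d y by rewrite mulr_ge0 ?ltW//; lra.
move: zx => h0; split => //; lra.
Qed.

Lemma whitney_map_near : near_maps (chain_const m * eps)
  (linear_part (whitney_map x)) (linear_part (whitney_map y)).
Proof.
have [_ dy ? ? ?] := index_point_scale; have dx := d_gt0 nEx.
exact: (near_chain eps_ge0 eps_le fA).
Qed.

Lemma whitney_map_dist w : enorm (w - x) <= d x ->
  enorm (whitney_map x w - whitney_map y w) <=
    value_const m * (eps * slope (p x) (d x) * d x).
Proof.
move=> wx; have [_ dy ? ? ?] := index_point_scale; have dx := d_gt0 nEx.
apply: (value_chain eps_ge0 eps_le fA) => //.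
rewrite (le_trans (enorm_distD x _ _))//.
have := p_dist x; have := exp2m_ge10.
by rewrite -(ler_pM2r dx); lra.
Qed.

End Local.

Lemma extension_notin x : ~ E x -> extension x =
  \sum_(i <- active d x) whitney_bump d i x *: whitney_map (index_point i) x.
Proof. by move=> nEx; rewrite /extension; case: asboolP. Qed.

Lemma extension_in x : E x -> extension x = f x.
Proof. by move=> Ex; rewrite /extension; case: asboolP. Qed.

Lemma extension_center x : ~ E x ->
  enorm (extension x - whitney_map x x) <=
    value_const m * (eps * slope (p x) (d x) * d x).
Proof.
move=> nEx; rewrite extension_notin//.
rewrite -[whitney_map x x in X in X <= _]scale1r -(sum_bump_active d x).
rewrite scaler_suml -sumrB (le_trans (ler_enorm_sum _ _))//.
rewrite -[leRHS]mul1r -(sum_bump_active d x) mulr_suml.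
rewrite big_seq [leRHS]big_seq; apply: ler_sum => i ix.
have xx : enorm (x - x) <= d x / 2.
  by rewrite subrr enorm0 divr_ge0// d_ge0.
rewrite -scalerBr enormZ ger0_norm ?bump_ge0// ler_wpM2l ?bump_ge0//.
rewrite enormB (whitney_map_dist nEx xx)// subrr enorm0; exact: d_ge0.
Qed.

Definition projection_const : R := 2 * value_const m + 7.

(** The centre p z has to be kept because the scale d z may be far below r;
    [downscale_value] compares the maps of the point p z at these two scales. *)
Lemma extension_at z r : 0 < r -> d z <= r ->
  enorm (extension z - A (p z) r z) <=
    projection_const * (eps * slope (p z) r * r).
Proof.
move=> r0 dr; have V0 := @value_const_ge0 R m.
have u0 : 0 <= eps * slope (p z) r * r.
  by rewrite !mulr_ge0 ?opnorm_ge0// ltW.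
have Vu : 0 <= value_const m * (eps * slope (p z) r * r) by exact: mulr_ge0.
have [Ez|nEz] := pselect (E z).
  rewrite extension_in// p_id//.
  apply: (le_trans (almost_affine_le fA Ez Ez r0 _)).
    by rewrite subrr enorm0 ltW.
  by move: u0 Vu; rewrite /projection_const p_id//; lra.
have dz := d_gt0 nEz.
rewrite (le_trans (enorm_distD (whitney_map z z) _ _))//.
have h1 := extension_center nEz.
have h2 : enorm (whitney_map z z - A (p z) r z) <=
    7 * (eps * slope (p z) r * r).
  by apply: (downscale_value eps_ge0 eps_le fA).
have h3 : value_const m * (eps * (slope (p z) (d z) * d z)) <=
    value_const m * (eps * (2 * (slope (p z) r * r))).
  by rewrite ler_wpM2l// ler_wpM2l// (downscale_slope eps_ge0 eps_le fA).
by rewrite /projection_const; lra.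
Qed.

Definition large_const : R :=
  2 * projection_const * (1 + chain_const m) + value_const m.

(** Since d z <= 2 r, the map at scale 2 r around p z describes the extension
    at z, and p z and p x are at distance at most 7 r. *)
Lemma extension_large x z r : 0 < r -> d x <= r -> enorm (z - x) <= r ->
  enorm (extension z - A (p x) r z) <=
    large_const * (eps * slope (p x) r * r).
Proof.
move=> r0 dr zx; have r20 : 0 < 2 * r by lra.
have dz : d z <= 2 * r by have := d_lip z x; lra.
have h1 := extension_at r20 dz.
have px := p_dist2 x z; rewrite (enormB x z) in px.
have T := exp2m_ge10.
have Tr : 10 * r <= 2 ^+ m * r by rewrite ler_wpM2r// ltW.
have hc : enorm (p x - p z) <= 2 ^+ m * r by lra.
have hc1 : r <= 2 ^+ m * (2 * r) by lra.
have hc2 : 2 * r <= 2 ^+ m * r by lra.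
have h2 := near_chain eps_ge0 eps_le fA (pE x) (pE z) r0 r20 hc hc1 hc2.
have hz : enorm (z - p x) <= 2 ^+ m * r.
  by have := enorm_distD x z (p x); have := p_dist x; lra.
have h3 := value_chain eps_ge0 eps_le fA (pE x) (pE z) r0 r20 hc hc1 hc2 hz.
have K1 := @chain_const_ge1 R m.
have k0 : 0 <= chain_const m * eps by rewrite mulr_ge0//; lra.
have h4 : slope (p z) (2 * r) <= (1 + chain_const m) * slope (p x) r.
  apply: (le_trans (near_maps_opnorm k0 h2)).
  rewrite ler_wpM2r ?opnorm_ge0// lerD2l ler_piMr//; move: eps_le; lra.
have a0 : 0 <= projection_const.
  by rewrite /projection_const; have := @value_const_ge0 R m; lra.
rewrite (le_trans (enorm_distD (A (p z) (2 * r) z) _ _))//.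
rewrite (enormB (A (p z) _ z)).
have h5 : projection_const * (eps * slope (p z) (2 * r) * (2 * r)) <=
    projection_const * (eps * ((1 + chain_const m) * slope (p x) r) * (2 * r)).
  by rewrite ler_wpM2l// ler_wpM2r ?(ltW r20)// ler_wpM2l.
rewrite /large_const; lra.
Qed.

Definition bump_lip_const : R := 1 + n%:R * expR 1.

Definition small_const : R :=
  (2 * (2 * 2 ^ n))%:R * (2 * bump_lip_const * value_const m)
    + chain_const m.

Lemma bump_lip_half i x z : ~ E x -> enorm (z - x) <= d x / 2 ->
  i \in active d x ++ active d z ->
  `|whitney_bump d i z - whitney_bump d i x| * d x <=
    2 * bump_lip_const * enorm (z - x).
Proof.
move=> nEx zx; have dx := d_gt0 nEx.
have dz := d_gt0 (half_notin nEx zx); have /andP[d1 d2] := half_ball_d nEx zx.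
have L0 : 0 <= bump_lip_const.
  by rewrite /bump_lip_const addr_ge0// mulr_ge0// expR_ge0.
set c := Num.min (d x) (d z).
have cd : d x / 2 <= c by rewrite le_min d1 andbT; lra.
have c0 : 0 < c by rewrite lt_min dx.
move=> ixz; suff h : `|whitney_bump d i z - whitney_bump d i x| <=
    bump_lip_const * enorm (z - x) / c.
  rewrite ler_pdivlMr// in h.
  have : `|whitney_bump d i z - whitney_bump d i x| * (d x / 2) <=
     `|whitney_bump d i z - whitney_bump d i x| * c by rewrite ler_wpM2l.
  lra.
move: ixz; rewrite mem_cat => /orP[ix|iz].
- rewrite distrC enormB; exact: bump_lip.
- rewrite /c minC; exact: bump_lip.
Qed.

(** Since the weights at x and at z both add up to 1, the affine map W of x can
    be subtracted from every term: only differences of weights multiplied by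
    small values, and differences of linear parts, remain. The common index
    list s allows the two sums to be compared term by term. *)
Lemma extension_small x z : ~ E x -> enorm (z - x) <= d x / 2 ->
  enorm (extension z - extension x - (z - x) *m linear_part (whitney_map x))
    <= small_const * (eps * slope (p x) (d x) * enorm (z - x)).
Proof.
move=> nEx zx; have nEz := half_notin nEx zx; have dx := d_gt0 nEx.
have xx : enorm (x - x) <= d x / 2 by rewrite subrr enorm0; lra.
pose W := whitney_map x; set L := linear_part W.
pose Q i := whitney_map (index_point i).
pose s := undup (active d x ++ active d z).
have us : uniq s by exact: undup_uniq.
have onto (V : lmodType R) (F : bump_index n -> V) w : w = x \/ w = z ->
    \sum_(i <- active d w) whitney_bump d i w *: F i =
    \sum_(i <- s) whitney_bump d i w *: F i.
  move=> w_xz; apply: big_uniq_support => //; first exact: uniq_active.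
    by move=> i iw; rewrite mem_undup mem_cat;
      case: w_xz iw => -> ->; rewrite ?orbT.
  by move=> i /bump_active ->; rewrite scale0r.
have sum1 w : w = x \/ w = z -> \sum_(i <- s) whitney_bump d i w = 1.
  move=> w_xz; rewrite -(sum_bump_active d w).
  have := onto R^o (fun=> 1) w w_xz.
  by rewrite -!scaler_suml /GRing.scale/= !mulr1 => ->.
have -> : extension z - extension x - (z - x) *m L =
    \sum_(i <- s) (whitney_bump d i z - whitney_bump d i x) *: (Q i z - W z) +
    \sum_(i <- s) whitney_bump d i x *: ((z - x) *m (linear_part (Q i) - L)).
  rewrite -big_split/=; transitivity (\sum_(i <- s)
      (whitney_bump d i z *: Q i z - whitney_bump d i x *: Q i x
       - (whitney_bump d i z *: W z - whitney_bump d i x *: W z)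
       - whitney_bump d i x *: ((z - x) *m L))).
    rewrite !sumrB -!scaler_suml !sum1; [|by left|by right].
    rewrite !scale1r subrr subr0 !extension_notin//.
    by rewrite !onto; [|by left|by right].
  apply: eq_bigr => i _; rewrite (affine_eval_diff (Q i) x z) mulmxBr.
  move: (W z) (Q i x) (_ *m _) (_ *m _) => w q l l'.
  move: (whitney_bump d i z) (whitney_bump d i x) => a b.
  apply/rowP => j; rewrite !mxE; ring.
have V0 := @value_const_ge0 R m.
have size_s : (size s <= 2 * (2 * 2 ^ n))%N.
  rewrite (leq_trans (size_undup _))// size_cat !size_active.
  by rewrite addnn [leqRHS]mul2n.
have k0 : 0 <= chain_const m * eps.
  by rewrite mulr_ge0//; have := @chain_const_ge1 R m; lra.
rewrite (le_trans (ler_enormD _ _))// /small_const.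
set u := eps * _ * _; rewrite [leRHS]mulrDl.
have iN i : i \in s -> i \in active d x \/ i \in active d z.
  by rewrite mem_undup mem_cat => /orP.
apply: lerD.
- rewrite (le_trans (ler_enorm_sum _ _))//.
  set b := 2 * bump_lip_const * value_const m * u.
  have b0 : 0 <= b.
    have L0 : 0 <= bump_lip_const.
      by rewrite /bump_lip_const addr_ge0// mulr_ge0// expR_ge0.
    have u0 : 0 <= u by rewrite !mulr_ge0 ?opnorm_ge0 ?enorm_ge0.
    by rewrite mulr_ge0 ?(mulr_ge0 _ V0)// mulr_ge0.
  apply: (@le_trans _ _ (\sum_(i <- s) b)); last first.
    rewrite big_const_seq count_predT iter_addr_0 -[b *+ _]mulr_natl -mulrA.
    by rewrite ler_wpM2r// ler_nat.
  rewrite big_seq [leRHS]big_seq; apply: ler_sum => i is_.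
  have h1 : enorm (Q i z - W z) <=
      value_const m * (eps * slope (p x) (d x) * d x).
    have zd : enorm (z - x) <= d x by lra.
    rewrite enormB; case: (iN i is_) => [ix|iz].
      exact: (whitney_map_dist nEx xx ix).
    exact: (whitney_map_dist nEx zx iz).
  have h2 : `|whitney_bump d i z - whitney_bump d i x| * d x <=
      2 * bump_lip_const * enorm (z - x).
    by apply: bump_lip_half => //; rewrite -mem_undup.
  rewrite enormZ.
  apply: (@le_trans _ _ (value_const m * (eps * slope (p x) (d x)) *
     (`|whitney_bump d i z - whitney_bump d i x| * d x))).
    rewrite (le_trans (ler_wpM2l _ h1))//.
    by rewrite le_eqVlt; apply/orP; left; apply/eqP; ring.
  rewrite (le_trans (ler_wpM2l _ h2))//.
    by rewrite !mulr_ge0// opnorm_ge0.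
  by rewrite le_eqVlt; apply/orP; left; apply/eqP; rewrite /b /u; ring.
- rewrite (le_trans (ler_enorm_sum _ _))//.
  rewrite -[leRHS]mul1r -(sum1 x); last by left.
  rewrite mulr_suml big_seq [leRHS]big_seq; apply: ler_sum => i is_.
  rewrite enormZ ger0_norm ?bump_ge0// ler_wpM2l ?bump_ge0//.
  rewrite (le_trans (enorm_mulmx_le _ _))// !mulrA ler_wpM2r ?enorm_ge0//.
  rewrite opnormB; apply: near_maps_l => //.
  case: (iN i is_) => [ix|iz].
    exact: (whitney_map_near nEx xx ix).
  exact: (whitney_map_near nEx zx iz).
Qed.

Lemma linear_part_extended x r : linear_part (extended_family x r) =
  linear_part (A (p x) (Num.max r (d x))).
Proof. by rewrite /extended_family; case: leP. Qed.

Lemma extended_compatible x y r s : 0 < r -> 0 < s ->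
  enorm (x - y) <= Num.max r s -> r <= 2 * s -> s <= 2 * r ->
  near_maps (chain_const m * eps)
    (linear_part (extended_family x r)) (linear_part (extended_family y s)).
Proof.
move=> r0 s0 xy rs sr; rewrite !linear_part_extended.
have [rx dx] : r <= Num.max r (d x) /\ d x <= Num.max r (d x).
  by rewrite !le_max !lexx orbT.
have [sy dy] : s <= Num.max s (d y) /\ d y <= Num.max s (d y).
  by rewrite !le_max !lexx orbT.
have xyr : enorm (x - y) <= 2 * r by rewrite (le_trans xy)// ge_max; lra.
have xys : enorm (x - y) <= 2 * s by rewrite (le_trans xy)// ge_max; lra.
have dxy := d_lip x y; have := d_lip y x; rewrite (enormB y) => dyx.
have rs3 : Num.max r (d x) <= 3 * Num.max s (d y) by rewrite ge_max; lra.
have sr3 : Num.max s (d y) <= 3 * Num.max r (d x) by rewrite ge_max; lra.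
move: (Num.max r _) (Num.max s _) rx dx sy dy rs3 sr3 => u v rx dx sy dy uv vu.
have T := exp2m_ge10; have [u0 v0] : 0 < u /\ 0 < v by lra.
have Tu : 10 * u <= 2 ^+ m * u by rewrite ler_wpM2r// ltW.
have Tv : 10 * v <= 2 ^+ m * v by rewrite ler_wpM2r// ltW.
apply: (near_chain eps_ge0 eps_le fA) => //; try lra.
by have := p_dist2 x y; lra.
Qed.

(** Between d x / 2 and d x the estimate at scale d x is applied at z and at x
    separately and costs a factor 4; below d x / 2 the Lipschitz estimate
    applies. *)
Lemma extended_family_le x r z : 0 < r -> enorm (z - x) <= r ->
  enorm (extension z - extended_family x r z) <=
    (4 * large_const + small_const) *
      (eps * opnorm (linear_part (extended_family x r)) * r).
Proof.
move=> r0 zx; rewrite linear_part_extended.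
have V0 := @value_const_ge0 R m; have K1 := @chain_const_ge1 R m.
have c1 : 0 <= large_const.
  by rewrite /large_const /projection_const addr_ge0// mulr_ge0//; lra.
have c2 : 0 <= small_const.
  rewrite /small_const /bump_lip_const addr_ge0//; last lra.
  by rewrite mulr_ge0// mulr_ge0// mulr_ge0// addr_ge0// mulr_ge0// expR_ge0.
have u0 : 0 <= eps * slope (p x) (Num.max r (d x)) * r.
  by rewrite !mulr_ge0 ?opnorm_ge0// ltW.
rewrite /extended_family; case: (leP (d x) r) u0 => [dr|rd] u0.
  apply: (le_trans (extension_large r0 dr zx)); rewrite ler_wpM2r//; lra.
have nEx : ~ E x by move=> /d_eq0; lra.
have dx := d_gt0 nEx; set L := linear_part _; set W := whitney_map x.
rewrite /affine_eval/=.
have -> : extension z - (z *m L + (extension x - x *m L)) =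
    extension z - extension x - (z - x) *m L.
  by rewrite mulmxBl; apply/rowP => j; rewrite !mxE; ring.
have [zs|zl] := leP (enorm (z - x)) (d x / 2).
  apply: (le_trans (extension_small nEx zs)).
  apply: (@le_trans _ _ (small_const * (eps * slope (p x) (d x) * r))).
    by rewrite ler_wpM2l// ler_wpM2l// mulr_ge0// opnorm_ge0.
  by rewrite ler_wpM2r//; lra.
have -> : extension z - extension x - (z - x) *m L =
    (extension z - W z) - (extension x - W x).
  by rewrite (affine_eval_diff W x z) -/L; apply/rowP => j; rewrite !mxE; ring.
rewrite (le_trans (ler_enormB _ _))//.
have h1 : enorm (extension z - W z) <=
    large_const * (eps * slope (p x) (d x) * d x).
  by apply: extension_large => //; lra.
have h2 : enorm (extension x - W x) <=
    large_const * (eps * slope (p x) (d x) * d x).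
  by apply: extension_large => //; rewrite subrr enorm0 ltW.
have h3 : large_const * (eps * slope (p x) (d x) * d x) <=
    large_const * (eps * slope (p x) (d x) * (2 * r)).
  rewrite ler_wpM2l// ler_wpM2l ?mulr_ge0 ?opnorm_ge0//; lra.
have h4 : 0 <= small_const * (eps * slope (p x) (d x) * r) by rewrite mulr_ge0.
lra.
Qed.

Lemma extended_family_in x r : E x -> 0 < r -> extended_family x r = A x r.
Proof. by move=> Ex r0; rewrite /extended_family d_eq0// ltW// p_id. Qed.

End Extension.

Lemma almost_affine_withI (R : realType) (n N : nat) (eps : R)
    (f : 'rV[R]_n -> 'rV[R]_N) (E : set 'rV[R]_n) (A : affine_family R n N) :
  (forall x y r s, E x -> E y -> 0 < r -> 0 < s ->
    enorm (x - y) <= Num.max r s -> r <= 2 * s -> s <= 2 * r ->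
    near_maps eps (linear_part (A x r)) (linear_part (A y s))) ->
  (forall x r z, E x -> E z -> 0 < r -> enorm (z - x) <= r ->
    enorm (f z - A x r z) <= eps * opnorm (linear_part (A x r)) * r) ->
  almost_affine_with eps f E A.
Proof.
move=> An fA; split.
  move=> x y r s Ex Ey r0 s0 xy; rewrite ler_pdivlMr// ler_pdivrMr// => sr rs.
  by apply: An => //; lra.
move=> x r Ex r0; apply: ge_ereal_sup => _ [z [Ez zx] <-].
by rewrite lee_fin; exact: fA.
Qed.

Theorem theorem8p1 (R : realType) (n : nat) (hn : (1 <= n)%N) :
  exists eps0 C0 : R, 0 < eps0 /\ 1 < C0 /\
    forall (N : nat) (E : set 'rV[R]_n) (f : 'rV[R]_n -> 'rV[R]_N)
      (A : affine_family R n N) (eps : R),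
      (n <= N)%N ->
      closed E ->
      E `<` [set: 'rV[R]_n] ->
      0 < eps -> eps <= eps0 ->
      almost_affine_with eps f E A ->
      exists F : 'rV[R]_n -> 'rV[R]_N,
        (forall x, E x -> F x = f x) /\
        almost_affine (C0 * eps) F [set: 'rV[R]_n] /\
        exists Aplus : affine_family R n N,
          (forall (x : 'rV[R]_n) (r : R), E x -> 0 < r -> Aplus x r = A x r) /\
          compatible (C0 * eps) [set: 'rV[R]_n] Aplus /\
          almost_affine_with (C0 * eps) F [set: 'rV[R]_n] Aplus.
Proof.
have [m m_large] := ex_exp2_ge
  (4 * expR 1 ^+ 2 + 4 * n%:R * expR 1 + 6 : R).
set C := Num.max (2 : R)
  (Num.max (chain_const m) (4 * large_const m + @small_const R n m)).
have [C2 CK CF] : [/\ 2 <= C, chain_const m <= C &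
    4 * large_const m + @small_const R n m <= C].
  by rewrite /C !le_max !lexx ?orbT.
exists 2^-1, C; split; first by rewrite invr_gt0.
split; first by lra.
move=> N E f A eps _ Ecl _ e0 e_le fA.
have Ce0 : 0 <= C * eps by rewrite mulr_ge0//; lra.
suff [F [B [FE BE FB]]] : exists F B, [/\ forall x, E x -> F x = f x,
    forall x r, E x -> 0 < r -> B x r = A x r &
    almost_affine_with (C * eps) F [set: 'rV[R]_n] B].
  exists F; split => //; split; first by exists B.
  by exists B; split => //; split => //; case: FB.
(* Over the empty set there is no nearest point; the zero family works. *)
have [E0|Ene] := eqVneq E set0.
  exists (fun=> 0), (fun _ _ => AffineMap 0 0).
  split => [x|x r|]; rewrite ?E0//; apply: almost_affine_withI => /=.
    by move=> *; rewrite /near_maps subr0 opnorm0 minxx mulr0.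
  by move=> *; rewrite /affine_eval/= mulmx0 addr0 subr0 enorm0 opnorm0
    mulr0 mul0r.
move/set0P in Ene.
have [d [p [d_lip d0 dpos pE pd]]] := distance_and_projection Ecl Ene.
have eps_ge0 := ltW e0.
exists (extension E f A d p), (extended_family E f A d p).
split.
- exact: extension_in.
- by move=> x r; apply: extended_family_in.
apply: almost_affine_withI => [x y r s _ _ r0 s0 xy rs sr|x r z _ _ r0 zx].
  apply: (@near_maps_le _ _ _ (chain_const m * eps)).
    by rewrite ler_wpM2r.
  exact: (extended_compatible eps_ge0 e_le fA).
apply: (le_trans (extended_family_le eps_ge0 e_le fA d_lip d0 dpos pE pd
  m_large r0 zx)).
rewrite -2!mulrA [leRHS]mulrA.
by rewrite -!mulrA ler_wpM2r// !mulr_ge0 ?opnorm_ge0// ltW.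
Qed.
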